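(* Let $P$ be a finite poset and let $A=(a_1,\dots,a_k)$, $k\ge 0$, be a finite sequence of elements of $P$. Then the elementary choice function $f_A$ associated with $A$ is a conservative choice function.
   Context: An (order) ideal of a poset $P$ is a subset $X\subseteq P$ such that $x\in X$, $y\le x$ imply $y\in X$; $\mathcal I(P)$ is the set of all ideals (including $\emptyset$ and $P$). For $S\subseteq P$, $I(S)=\{y\in P : y\le s\text{ for some }s\in S\}$ is the ideal generated by $S$. A choice function (CF) on $P$ is a map $f:\mathcal I(P)\to\mathcal I(P)$ with $f(X)\subseteq X$ for every ideal $X$. It has the heredity property if for all ideals $A\subseteq B$ one has $f(B)\cap A\subseteq f(A)$. It has the outcast property if for all ideals $A,B$ with $f(B)\subseteq A\subseteq B$ one has $f(A)=f(B)$. A CF is conservative if it has both the heredity and the outcast properties. Elementary CF: for a finite sequence $A=(a_1,\dots,a_k)$, $k\ge 0$, of elements of $P$ and an ideal $X$, let $i$ be the least index with $a_i\in X$; if no $a_i$ belongs to $X$, put $i=k$ (so $i=0$ if $k=0$). Then $f_A(X)=X\cap I(\{a_1,\dots,a_i\})$; in particular $f_\emptyset(X)=\emptyset$ for the empty sequence. *)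

(* Defs.v *)
From HB Require Import structures.
From mathcomp Require Import all_boot all_order.
Set Implicit Arguments.
Unset Strict Implicit.
Unset Printing Implicit Defensive.
Import Order.TTheory.
Local Open Scope order_scope.

Section Ideals.
Context {d : Order.disp_t} {P : finPOrderType d}.

Definition is_ideal (X : {set P}) : bool :=
  [forall x in X, forall y, (y <= x) ==> (y \in X)].

Lemma is_idealP (X : {set P}) :
  reflect (forall x y, x \in X -> y <= x -> y \in X) (is_ideal X).
Proof.
apply: (iffP forall_inP) => [idX x y xX yx | idX x xX].
  exact: (implyP (forallP (idX x xX) y)).
by apply/forallP => y; apply/implyP; apply: idX.
Qed.

Definition generated_ideal (S : {set P}) : {set P} :=
  [set y | [exists s in S, y <= s]].

Lemma generated_ideal_is_ideal (S : {set P}) : is_ideal (generated_ideal S).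
Proof.
apply/is_idealP => x y; rewrite !inE => /exists_inP[s sS xs] yx.
by apply/exists_inP; exists s => //; apply: le_trans xs.
Qed.

Lemma is_idealI (X Y : {set P}) :
  is_ideal X -> is_ideal Y -> is_ideal (X :&: Y).
Proof.
move=> /is_idealP idX /is_idealP idY; apply/is_idealP => x y.
rewrite !inE => /andP[xX xY] yx; apply/andP; split.
  exact: idX xX yx.
exact: idY xY yx.
Qed.

End Ideals.

Section ChoiceFunctions.
Context {d : Order.disp_t} (P : finPOrderType d).

Record ideal : Type := Ideal { ideal_set :> {set P}; _ : is_ideal ideal_set }.

HB.instance Definition _ := [isSub for ideal_set].
HB.instance Definition _ := [Finite of ideal by <:].

Lemma ideal_setP (X : ideal) : is_ideal X.
Proof. exact: valP X. Qed.

Implicit Type f : ideal -> ideal.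

Definition choice_function f : Prop := forall X : ideal, f X \subset X.

Definition heredity f : Prop :=
  forall A B : ideal, A \subset B -> f B :&: A \subset f A.

Definition outcast f : Prop :=
  forall A B : ideal, f B \subset A -> A \subset B -> f A = f B.

Definition conservative f : Prop := heredity f /\ outcast f.

(* The index i is 1-based, whereas [find] is 0-based and returns [size A] when
   no term of A belongs to X. *)
Definition first_index (A : seq P) (X : ideal) : nat :=
  if has [in X] A then (find [in X] A).+1 else size A.

Definition elementary_set (A : seq P) (X : ideal) : {set P} :=
  X :&: generated_ideal [set a in take (first_index A X) A].

Lemma elementary_set_is_ideal (A : seq P) (X : ideal) :
  is_ideal (elementary_set A X).
Proof. exact: is_idealI (ideal_setP X) (generated_ideal_is_ideal _). Qed.

Definition elementary_cf (A : seq P) (X : ideal) : ideal :=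
  Ideal (elementary_set_is_ideal A X).

End ChoiceFunctions.

(* Main.v *)
Require Import Defs.
From mathcomp Require Import all_boot all_order.

Import Order.TTheory.

(** Call the pivot of [X] the least index of a term of [A] lying in [X].  The
    set [f_A X] is cut out of [X] by the prefix of [A] ending at the pivot, or
    by all of [A] when there is no pivot.

    Heredity: the smaller the ideal, the later its pivot, hence the longer the
    prefix.  So an element of the small ideal that is selected in the large
    one stays below some term of the prefix for the small one.

    Outcast: a pivot term of the large ideal [Y] is itself selected
    ([elementary_cf_pivot]), so an ideal [X] between [f_A Y] and [Y] has the
    same pivot ([find_outcast]).  The prefixes for [X] and [Y] thus coincide,
    and they select the same elements, as those selected in [Y] lie in [X]. *)

(** Cutting one past [find] treats both cases of [first_index] at once: when no
    term of [A] is in [X], [find] is [size A] and the prefix is all of [A]. *)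
Lemma mem_elementary_cf {d : Order.disp_t} {P : finPOrderType d}
    (A : seq P) (X : ideal P) (y : P) :
  (y \in (elementary_cf A X : {set P})) =
  (y \in (X : {set P})) && has (fun a => y <= a)%O (take (find [in X] A).+1 A).
Proof.
have -> : take (find [in X] A).+1 A = take (first_index A X) A.
  rewrite /first_index; case: ifPn => // /hasNfind ->.
  by rewrite take_size take_oversize.
rewrite !inE; congr (_ && _); apply/exists_inP/hasP => -[a].
  by rewrite inE => aA ya; exists a.
by move=> aA ya; exists a; rewrite ?inE.
Qed.

Lemma find_ideal_anti {d : Order.disp_t} {P : finPOrderType d}
    (A : seq P) (X Y : ideal P) :
  X \subset Y -> find [in Y] A <= find [in X] A.
Proof. by move=> /subsetP sXY; apply: sub_find => a; apply: sXY. Qed.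

Lemma elementary_cf_pivot {d : Order.disp_t} {P : finPOrderType d}
    (A : seq P) (X : ideal P) (x0 : P) :
  has [in X] A -> nth x0 A (find [in X] A) \in (elementary_cf A X : {set P}).
Proof.
move=> hasX; rewrite mem_elementary_cf; apply/andP; split.
  exact: nth_find hasX.
apply/hasP; exists (nth x0 A (find [in X] A)); last exact: lexx.
rewrite -(nth_take x0 (ltnSn _)) mem_nth // size_takel //.
by rewrite -has_find.
Qed.

(** Selection keeps the pivot term, so a pivot can be neither gained nor moved
    by discarding elements that were not selected. *)
Lemma find_outcast {d : Order.disp_t} {P : finPOrderType d}
    (A : seq P) (X Y : ideal P) :
  elementary_cf A Y \subset X -> X \subset Y -> find [in X] A = find [in Y] A.
Proof.
move=> /subsetP sfYX sXY; apply/eqP; rewrite eqn_leq (find_ideal_anti A X Y) // andbT.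
case: (boolP (has [in Y] A)) => [hasY | /hasNfind ->]; last exact: find_size.
have [x0 _ _] := hasP hasY.
rewrite leqNgt; apply/negP => /(before_find x0) /negP; apply.
exact/sfYX/elementary_cf_pivot.
Qed.

Theorem proposition1 (d : Order.disp_t) (P : finPOrderType d) (A : seq P) :
  choice_function (elementary_cf A) /\ conservative (elementary_cf A).
Proof.
split; first by move=> X; exact: subsetIl.
split=> [X Y sXY | X Y sfYX sXY].
  apply/subsetP => y; rewrite in_setI !mem_elementary_cf.
  case/andP=> /andP[_ /hasP[a aY ya]] -> /=; apply/hasP; exists a => //.
  (* the prefix cut at Y is a prefix of the prefix cut at X *)
  move: aY; rewrite -(take_takel A (_ : _ <= (find [in X] A).+1)).
    exact: mem_take.
  by rewrite ltnS find_ideal_anti.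
apply/val_inj/setP => y; apply/idP/idP => yf.
  move: (yf); rewrite !mem_elementary_cf (find_outcast A X Y) //.
  by case/andP=> /(subsetP sXY) -> ->.
move: (subsetP sfYX y yf) (yf) => yX.
by rewrite !mem_elementary_cf (find_outcast A X Y) // yX => /andP[_ ->].
Qed.
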